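(* Let $s\ge 1$ and $t\ge 1$ be integers. Then $\chi_p(P_{4t}\Diamond_4 C_{4s+1})\le 5$.
   Context: A packing $k$-coloring of a graph $H$ is a map $c:V(H)\to\{1,\ldots,k\}$ such that any two distinct vertices $u,v$ with $c(u)=c(v)=i$ satisfy $d_H(u,v)\ge i+1$. The packing chromatic number $\chi_p(H)$ is the least such $k$. $P_m$ denotes the path $v_1\cdots v_m$ and $C_n$ the cycle on $n$ vertices. Path-aligned product: for positive integers $\ell\mid m$ and a connected vertex-transitive graph $G$ containing $P_\ell$ as a subgraph, $P_m\Diamond_\ell G$ is formed from the path $P_m=v_1\cdots v_m$ and $m/\ell$ pairwise disjoint copies of $G$, where for each $1\le i\le m/\ell$ the consecutive path vertices $v_{(i-1)\ell+1},\ldots,v_{i\ell}$ are identified, in order, with the vertices of a path $P_\ell$ (i.e. $\ell$ consecutive cycle vertices when $G$ is a cycle) in the $i$-th copy of $G$. *)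

(* Defs.v *)
From mathcomp Require Import all_boot.

Set Implicit Arguments.
Unset Strict Implicit.
Unset Printing Implicit Defensive.

Record sgraph := SGraph {
  vertex :> finType;
  adj : rel vertex;
  adj_sym : symmetric adj;
  adj_irrefl : irreflexive adj }.

Arguments adj {s} : rename.

Section Distance.
Variable H : sgraph.
Implicit Types u v : H.

Definition walk u v n : bool :=
  [exists p : n.-tuple H, path adj u p && (last u p == v)].

Lemma connect_walk u v : connect adj u v -> exists n, walk u v n.
Proof.
move=> /connectP[p pathp ->]; exists (size p).
by apply/existsP; exists (in_tuple p); rewrite pathp eqxx.
Qed.

(* None stands for an infinite distance. *)
Definition dist u v : option nat :=
  if @idP (connect adj u v) is ReflectT uv
  then Some (ex_minn (connect_walk uv)) else None.

Definition dist_geq u v n : bool :=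
  if dist u v is Some d then n <= d else true.

End Distance.

Section PackingColoring.
Variable H : sgraph.

Definition packing_coloring k (c : {ffun H -> 'I_k.+1}) : bool :=
  [forall u, 1 <= c u <= k] &&
  [forall u, forall v, (u != v) && (c u == c v) ==> dist_geq u v (c u).+1].

Definition packing_colorable k : bool :=
  [exists c : {ffun H -> 'I_k.+1}, packing_coloring c].

Lemma packing_colorable_ex : exists k, packing_colorable k.
Proof.
exists #|H|; apply/existsP.
exists [ffun x => lift ord0 (enum_rank x)]; apply/andP; split.
  by apply/forallP => u; rewrite ffunE lift0 ltn_ord.
apply/forallP => u; apply/forallP => v; apply/implyP; rewrite !ffunE.
by move=> /andP[/eqP uv /eqP /lift_inj /enum_rank_inj].
Qed.

Definition packing_chromatic_number : nat := ex_minn packing_colorable_ex.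

End PackingColoring.

(* Path vertices are numbered from 0: v_{j+1} is (j : 'I_m). *)
Definition path_adj m : rel 'I_m := fun i j => (i.+1 == j) || (j.+1 == i).

Lemma path_adj_sym m : symmetric (@path_adj m).
Proof. by move=> i j; rewrite /path_adj orbC. Qed.

Lemma path_adj_irrefl m : irreflexive (@path_adj m).
Proof. by move=> i; rewrite /path_adj orbb gtn_eqF. Qed.

Definition path_graph m := SGraph (@path_adj_sym m) (@path_adj_irrefl m).

(* The condition i != j only matters for n = 1. *)
Definition cycle_adj n : rel 'I_n :=
  fun i j => (i != j) && ((ordS i == j) || (ordS j == i)).

Lemma cycle_adj_sym n : symmetric (@cycle_adj n).
Proof. by move=> i j; rewrite /cycle_adj eq_sym orbC. Qed.

Lemma cycle_adj_irrefl n : irreflexive (@cycle_adj n).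
Proof. by move=> i; rewrite /cycle_adj eqxx. Qed.

Definition cycle_graph n := SGraph (@cycle_adj_sym n) (@cycle_adj_irrefl n).

Record embedding (F G : sgraph) := Embedding {
  emb_fun :> F -> G;
  emb_inj : injective emb_fun;
  emb_adj : forall x y, adj x y -> adj (emb_fun x) (emb_fun y) }.

Section PathAlignedProduct.
Variables (m l : nat) (G : sgraph).
Variable f : 'I_(m %/ l) -> embedding (path_graph l) G.

(* For l %| m, every vertex of P_m is identified with a vertex of some copy of
   G, so the vertices of the product are those of the m %/ l copies of G:
   (i, x) is the vertex x of the i-th copy. *)
Definition product_vertex : finType := ('I_(m %/ l) * G)%type.

(* The r-th vertex of the i-th block of P_m is identified with the r-th vertex
   of the chosen path f i in the i-th copy of G. *)
Definition identified (j : path_graph m) (x : product_vertex) : bool :=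
  [exists r : 'I_l, (j == x.1 * l + r :> nat) && (f x.1 r == x.2)].

Definition product_adj : rel product_vertex := fun x y =>
  ((x.1 == y.1) && adj x.2 y.2) ||
  [exists a, exists b, [&& adj a b, identified a x & identified b y]].

Lemma product_adj_sym : symmetric product_adj.
Proof.
move=> x y; rewrite /product_adj eq_sym adj_sym; congr orb.
by apply/existsP/existsP => -[a /existsP[b /and3P[ab ax b_y]]]; exists b;
  apply/existsP; exists a; rewrite adj_sym ab ax b_y.
Qed.

Lemma product_adj_irrefl : irreflexive product_adj.
Proof.
move=> x; rewrite /product_adj adj_irrefl andbF /=; apply/negbTE/negP.
move=> /existsP[a /existsP[b /and3P[ab]]].
move=> /existsP[r /andP[/eqP ar /eqP fr]] /existsP[q /andP[/eqP bq /eqP fq]].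
have rq : r = q by apply: (@emb_inj _ _ (f x.1)); rewrite fr fq.
have eab : a = b by apply: val_inj; rewrite /= ar bq rq.
by move: ab; rewrite eab path_adj_irrefl.
Qed.

Definition path_aligned_product : sgraph :=
  SGraph product_adj_sym product_adj_irrefl.

End PathAlignedProduct.

Arguments path_aligned_product m {l G} f.

(* Main.v *)
Require Import Defs.
From mathcomp Require Import all_boot.
From mathcomp Require Import zify.

(** Number the vertices of each copy of the cycle by their offset from the
    first path vertex, in the direction of the path.  The offsets 0, ..., 4s
    get the colors 2 1 3 x followed by 1 2 1 3 ... 1 2 1 3 1, where x alternates
    between 4 and 5 along the copies.  A distance is at least [h v - h u] for
    any 1-Lipschitz [h], and such potentials with [h u = 0] separate all
    vertices of equal color. *)

Lemma path_lipschitz (T : eqType) (e : rel T) (h : T -> nat) (u : T) p :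
  (forall x y, e x y -> h y <= (h x).+1) -> path e u p ->
  h (last u p) <= h u + size p.
Proof.
move=> hL; elim: p u => [|y p IHp] u /=; first by rewrite addn0.
move=> /andP[uy /IHp le_p]; apply: leq_trans le_p _.
by rewrite addnS -addSn leq_add2r hL.
Qed.

Lemma dist_geq_lipschitz (H : sgraph) (h : H -> nat) (u v : H) d :
  (forall x y, adj x y -> h y <= (h x).+1) -> h u + d <= h v ->
  dist_geq u v d.
Proof.
move=> hL le_uv; rewrite /dist_geq /dist; case: {-}_ / idP => [uv|//].
case: ex_minnP => n /existsP[p /andP[pp /eqP lp]] _.
have := path_lipschitz _ _ _ _ _ hL pp; rewrite lp size_tuple => le_v.
by rewrite -(leq_add2l (h u)) (leq_trans le_uv le_v).
Qed.

Lemma dist_geq_sym (H : sgraph) (u v : H) d :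
  dist_geq u v d -> dist_geq v u d.
Proof.
have walk_sym (x y : H) n : walk x y n -> walk y x n.
  move=> /existsP[p /andP[pp /eqP lp]]; apply/existsP.
  have sz : size (rev (belast x p)) == n by rewrite size_rev size_belast size_tuple.
  exists (Tuple sz); rewrite /= -lp rev_path.
  rewrite (eq_path (e' := adj)) ?pp => [|a b]; last by rewrite adj_sym.
  by case: (tval p) => //= z q; rewrite rev_cons last_rcons.
rewrite /dist_geq /dist.
case: {-}_ / idP => [uv|nuv] duv; case: {-}_ / idP => [vu|nvu] //.
  move: duv; case: ex_minnP => a _ amin; case: ex_minnP => b wb _ /leq_trans.
  by apply; apply/amin/walk_sym.
case: nuv; have [n /walk_sym/existsP[p /andP[pp /eqP lp]]] := connect_walk vu.
by apply/connectP; exists p.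
Qed.

Definition cyc_next n a b := (b == a.+1) || (a.+1 == n) && (b == 0).

Definition cyc_near n a b := cyc_next n a b || cyc_next n b a.

Lemma cycle_adj_near n (x y : cycle_graph n) : adj x y -> cyc_near n x y.
Proof.
have ordS_next (a b : 'I_n) : ordS a == b -> cyc_next n a b.
  move=> /eqP <-; rewrite /cyc_next /=.
  have := ltn_ord a; rewrite leq_eqVlt => /orP[/eqP -> | lt_a].
    by rewrite modnn !eqxx orbT.
  by rewrite modn_small ?eqxx.
by case/andP => _ /orP[] /ordS_next; rewrite /cyc_near => -> //; rewrite orbT.
Qed.

Definition cyc_off n a x := if a <= x then x - a else x + n - a.

Definition cyc_dist n a b := minn ((a - b) + (b - a)) (n - ((a - b) + (b - a))).

Lemma cyc_dist_near n a x y :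
  a < n -> x < n -> y < n -> cyc_near n x y ->
  cyc_dist n a y <= (cyc_dist n a x).+1.
Proof. rewrite /cyc_near /cyc_next /cyc_dist; lia. Qed.

Section PathOffset.
Variables (n : nat) (g : embedding (path_graph 4) (cycle_graph n)).
Hypothesis n_gt4 : 4 < n.

Definition path_off (x : 'I_n) : nat :=
  if cyc_off n (g (inord 0)) (g (inord 1)) == 1
  then cyc_off n (g (inord 0)) x else cyc_off n x (g (inord 0)).

Lemma path_off_lt x : path_off x < n.
Proof.
have := ltn_ord x; have := ltn_ord (g (inord 0)).
rewrite /path_off /cyc_off; do ! case: ifP; lia.
Qed.

Lemma path_off_inj : injective path_off.
Proof.
move=> x y; have := ltn_ord x; have := ltn_ord y.
have := ltn_ord (g (inord 0)); move=> a b c e; apply: val_inj => /=.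
move: a b c e; rewrite /path_off /cyc_off; do ! case: ifP; lia.
Qed.

Lemma path_off_near (x y : cycle_graph n) :
  adj x y -> cyc_near n (path_off x) (path_off y).
Proof.
move=> /cycle_adj_near; have := ltn_ord x; have := ltn_ord y.
have := ltn_ord (g (inord 0)).
rewrite /path_off /cyc_off /cyc_near /cyc_next; do ! case: ifP; lia.
Qed.

Lemma path_off_emb (r : 'I_4) : path_off (g r) = r.
Proof.
have step k : k < 3 -> cyc_near n (path_off (g (inord k))) (path_off (g (inord k.+1))).
  move=> k3; apply/path_off_near/emb_adj.
  by rewrite /= /path_adj !inordK ?eqxx // ltnW.
have neq k : k < 2 -> path_off (g (inord k)) <> path_off (g (inord k.+2)).
  move=> k2 /path_off_inj/(@emb_inj _ _ g)/(congr1 val); rewrite /= !inordK //; lia.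
have lt k := path_off_lt (g (inord k)).
have e0 : path_off (g (inord 0)) = 0 by rewrite /path_off /cyc_off; do ! case: ifP; lia.
have e1 : path_off (g (inord 1)) = 1.
  move: (step 0 isT) (lt 1); rewrite e0 /cyc_near /cyc_next.
  have := ltn_ord (g (inord 0)); have := ltn_ord (g (inord 1)).
  rewrite /path_off /cyc_off; do ! case: ifP; lia.
have e2 : path_off (g (inord 2)) = 2.
  move: (step 1 isT) (neq 0 isT); rewrite e0 e1 /cyc_near /cyc_next; lia.
have e3 : path_off (g (inord 3)) = 3.
  move: (step 2 isT) (neq 1 isT); rewrite e1 e2 /cyc_near /cyc_next; lia.
by rewrite -[in LHS](inord_val r); case: r => [[|[|[|[|k]]]] //=].
Qed.

End PathOffset.

Definition off_color (i k : nat) : nat :=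
  if k < 4 then nth 0 [:: 2; 1; 3; 4 + odd i] k
  else nth 0 [:: 1; 2; 1; 3] (k %% 4).

Lemma off_colorP i k :
  [\/ off_color i k = 1 /\ (k = 1 \/ 4 <= k /\ ~~ odd k),
      off_color i k = 2 /\ (k = 0 \/ 4 <= k /\ k %% 4 = 1),
      off_color i k = 3 /\ (k = 2 \/ 4 <= k /\ k %% 4 = 3) |
      off_color i k = 4 + odd i /\ k = 3].
Proof.
rewrite /off_color; case: ltnP => [|k4].
  case: k => [|[|[|[|k]]]] //= _.
  - by constructor 2; split; [|left].
  - by constructor 1; split; [|left].
  - by constructor 3; split; [|left].
  - by constructor 4.
have : k %% 4 < 4 by rewrite ltn_mod.
case E: (k %% 4) => [|[|[|[|m]]]] //= _.
- by constructor 1; split=> //; right; split; lia.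
- by constructor 2; split=> //; right.
- by constructor 1; split=> //; right; split; lia.
- by constructor 3; split=> //; right.
Qed.

Lemma off_color_bounds i k : 1 <= off_color i k <= 5.
Proof. case: (off_colorP i k) => -[-> _] //; by case: odd. Qed.

Lemma off_color_same_copy s i k k' :
  k < 4 * s + 1 -> k' < 4 * s + 1 -> k <> k' ->
  off_color i k = off_color i k' ->
  off_color i k < cyc_dist (4 * s + 1) k k'.
Proof.
rewrite /cyc_dist => lt_k lt_k' kk'.
case: (off_colorP i k) => -[-> hk]; case: (off_colorP i k') => -[-> hk']; lia.
Qed.

Lemma off_color_two_copies s i i' k k' :
  0 < s -> k < 4 * s + 1 -> k' < 4 * s + 1 -> i < i' ->
  off_color i k = off_color i' k' ->
  off_color i k < cyc_dist (4 * s + 1) k 3 + 1 + 3 * (i' - i.+1)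
                  + cyc_dist (4 * s + 1) 0 k'.
Proof.
rewrite /cyc_dist => s0 lt_k lt_k' ii'.
case: (off_colorP i k) => -[-> hk]; case: (off_colorP i' k') => -[-> hk']; lia.
Qed.

Section Coloring.
Variables (s t : nat).
Hypothesis s_gt0 : 0 < s.
Let n := 4 * s + 1.
Variable f : 'I_((4 * t) %/ 4) -> embedding (path_graph 4) (cycle_graph n).
Let H := path_aligned_product (4 * t) f.

Let off (x : H) : nat := path_off _ (f x.1) x.2.

Let n_gt4 : 4 < n. Proof. rewrite /n; lia. Qed.

Let off_lt x : off x < n. Proof. exact: path_off_lt. Qed.

Lemma product_adj_off (x y : H) : adj x y ->
  [\/ x.1 = y.1 /\ cyc_near n (off x) (off y),
      [/\ x.1.+1 = y.1 :> nat, off x = 3 & off y = 0] |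
      [/\ y.1.+1 = x.1 :> nat, off y = 3 & off x = 0]].
Proof.
case: x y => [i x] [j y] /= /orP[/andP[/eqP /= -> xy]|].
  by constructor 1; split=> //; apply: path_off_near.
move=> /existsP[a /existsP[b /and3P[ab]]].
move=> /existsP[r /andP[/eqP /= ar /eqP fr]] /existsP[q /andP[/eqP /= bq /eqP fq]].
rewrite /off /= -fr -fq !path_off_emb //.
have := ltn_ord r; have := ltn_ord q.
move: ab; rewrite /= /path_adj ar bq => ab lt_q lt_r.
have [ij|ij] := eqVneq (i : nat) j.
  constructor 1; split; first exact: val_inj.
  by move: ab; rewrite ij /cyc_near /cyc_next; lia.
have [lt_ij|le_ji] := ltnP i j; first by constructor 2; split; lia.
by constructor 3; split; lia.
Qed.

(* The increment per copy is 3 rather than 4 because of s = 1: the ends of the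
   path in a 5-cycle are only 2 apart. *)
Let potential (u v : H) : nat :=
  if v.1 < u.1 then cyc_dist n (off u) 0
  else if v.1 == u.1 then cyc_dist n (off u) (off v)
  else cyc_dist n (off u) 3 + 1 + 3 * (v.1 - u.1.+1) + cyc_dist n 0 (off v).

Lemma potential_lipschitz u (x y : H) :
  adj x y -> potential u y <= (potential u x).+1.
Proof.
have eq_ordE (i j : 'I_((4 * t) %/ 4)) : (i == j) = (i == j :> nat) by [].
have := off_lt x; have := off_lt y; have := off_lt u.
move=> lt_u lt_y lt_x /product_adj_off[[e near]|[e ex ey]|[e ey ex]].
- have near0 := cyc_dist_near _ 0 _ _ (leq_ltn_trans (leq0n 4) n_gt4) lt_x lt_y near.
  have near_u := cyc_dist_near _ _ _ _ lt_u lt_x lt_y near.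
  by rewrite /potential e; case: ifP => // _; case: ifP => // _; lia.
- rewrite /potential !eq_ordE ex ey -e; move: n_gt4 lt_u.
  by do ! case: ifP; rewrite /cyc_dist; lia.
rewrite /potential !eq_ordE ex ey -e; move: n_gt4 lt_u.
by do ! case: ifP; rewrite /cyc_dist; lia.
Qed.

Lemma product_packing_colorable : packing_colorable H 5.
Proof.
pose col (x : H) := off_color x.1 (off x).
have colP x : 1 <= col x <= 5 by exact: off_color_bounds.
have colK x : inord (col x) = col x :> nat := inordK (proj2 (andP (colP x))).
apply/existsP; exists [ffun x => inord (col x)]; apply/andP; split.
  by apply/forallP => x; rewrite ffunE colK colP.
apply/forallP => u; apply/forallP => v; apply/implyP; rewrite !ffunE.
move=> /andP[uv /eqP/(congr1 val)]; rewrite /= !colK => {colP colK}.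
wlog le_uv : u v uv / u.1 <= v.1 => [IH|] cuv.
  case: (leqP u.1 v.1) => [|/ltnW] le_uv; first exact: IH.
  by rewrite cuv; apply/dist_geq_sym/IH; rewrite // eq_sym.
apply: (dist_geq_lipschitz _ (potential u)); first exact: potential_lipschitz.
have -> : potential u u = 0.
  by rewrite /potential ltnn eqxx /cyc_dist subnn min0n.
rewrite add0n /potential [v.1 < u.1]ltnNge le_uv /=; case: eqVneq => [e|ne].
  have off_uv : off u <> off v.
    rewrite /off => off_uv; case/eqP: uv.
    case: u v e off_uv {le_uv cuv} => [i x] [j y] /= <-.
    by move=> /path_off_inj ->.
  by move: cuv; rewrite /col e; apply: off_color_same_copy.
apply: off_color_two_copies => //.
by rewrite ltn_neqAle le_uv andbT; apply: contra_neq ne => /val_inj.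
Qed.

End Coloring.

Theorem theorem14 (s t : nat) (hs : 1 <= s) (ht : 1 <= t)
    (f : 'I_((4 * t) %/ 4) ->
         embedding (path_graph 4) (cycle_graph (4 * s + 1))) :
  packing_chromatic_number (path_aligned_product (4 * t) f) <= 5.
Proof.
rewrite /packing_chromatic_number; case: ex_minnP => k _; apply.
exact: product_packing_colorable.
Qed.
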